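(* Let $\epsilon>0$, and for $x\in\mathbb{R}^d$ let $\mathcal{S}(x)=\{x':\|x'-x\|_p\le\epsilon\}$. Let $f_\theta$ be a deep neural network classifier with parameters $\theta$ that predicts probabilities over the classes $\{1,\dots,C\}$, let $\mathcal{L}(f_\theta(x),y)=-\mathbf{1}_y^\top\log f_\theta(x)$ be the cross-entropy loss, and let $\mathcal{J}(x,y,\theta)=\max_{x'\in\mathcal{S}(x)}\mathcal{L}(f_\theta(x'),y)$ be the adversarial loss. Suppose the gradient of the clean cross-entropy loss is locally Lipschitz continuous in the sense that $$\|\nabla_\theta\mathcal{L}(f_\theta(x'),y)-\nabla_\theta\mathcal{L}(f_\theta(x),y)\|_2\le K\|x'-x\|_p$$ for any $x\in\mathbb{R}^d$, any $x'\in\mathcal{S}(x)$, and any $\theta$, where $K$ is the Lipschitz constant. Then $$\|\nabla_\theta\mathcal{J}(x,y,\theta_1)-\nabla_\theta\mathcal{J}(x,y,\theta_2)\|_2\le\|\nabla_\theta\mathcal{L}(f_{\theta_1}(x),y)-\nabla_\theta\mathcal{L}(f_{\theta_2}(x),y)\|_2+2\epsilon K.$$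
   Context: Here $x\in\mathbb{R}^d$ is a natural example, $y\in\{1,\dots,C\}$ is its label, $\mathbf{1}_y$ is the one-hot vector of $y$ (so $\mathcal{L}(f_\theta(x),y)$ is minus the logarithm of the probability that $f_\theta(x)$ assigns to class $y$), and $\theta_1,\theta_2$ are two values of the parameters. $\|\cdot\|_p$ is the $\ell_p$ norm (e.g. $\ell_2$ or $\ell_\infty$) and $\|\cdot\|_2$ is the Euclidean norm. $\nabla_\theta$ denotes the gradient with respect to the parameters; $\nabla_\theta\mathcal{L}(f_{\theta_i}(x),y)$ and $\nabla_\theta\mathcal{J}(x,y,\theta_i)$ are the gradients with respect to $\theta$ of $\mathcal{L}(f_\theta(x),y)$ and $\mathcal{J}(x,y,\theta)$ taken at $\theta=\theta_i$. *)

(* Defs.v *)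
From HB Require Import structures.
From mathcomp Require Import all_boot all_order all_algebra.
From mathcomp Require Import all_classical all_reals all_analysis.

Set Implicit Arguments.
Unset Strict Implicit.
Unset Printing Implicit Defensive.

Import Order.TTheory GRing.Theory Num.Theory.
Import numFieldNormedType.Exports.

Local Open Scope classical_set_scope.
Local Open Scope ring_scope.

(* This is a norm exactly when 1 <= p; the value at p = -oo is irrelevant. *)
Definition lp_norm (R : realType) (n : nat) (p : \bar R) (v : 'rV[R]_n) : R :=
  match p with
  | r%:E => (\sum_(i < n) `|v 0 i| `^ r) `^ r^-1
  | +oo%E => \big[Num.max/0]_(i < n) `|v 0 i|
  | -oo%E => 0
  end.

Definition l2_norm (R : realType) (n : nat) (v : 'rV[R]_n) : R :=
  Num.sqrt (\sum_(i < n) v 0 i ^+ 2).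

Definition lp_ball (R : realType) (d : nat) (p : \bar R) (eps : R)
    (x : 'rV[R]_d) : set 'rV[R]_d :=
  [set x' | lp_norm p (x' - x) <= eps].

(* The vector of partial derivatives; it represents the differential of F at
   theta whenever F is differentiable there. *)
Definition gradient (R : realType) (m : nat) (F : 'rV[R]_m -> R)
    (theta : 'rV[R]_m) : 'rV[R]_m :=
  \row_(i < m) 'D_(delta_mx 0 i) F theta.

(* Positivity, as provided by a softmax output layer, is what makes the
   entrywise logarithm of the prediction meaningful. *)
Definition positive_probability (R : realType) (C : nat) (q : 'rV[R]_C) : Prop :=
  (forall c, 0 < q 0 c) /\ \sum_(c < C) q 0 c = 1.

(* A network enters only through its input-output map f theta, whatever its
   architecture: every network with continuous layers and a softmax output
   satisfies this, and continuity in the input makes the adversarial maximum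
   exist. *)
Definition network_classifier (R : realType) (m d C : nat)
    (f : 'rV[R]_m -> 'rV[R]_d -> 'rV[R]_C) : Prop :=
  forall theta, continuous (f theta) /\
    forall x, positive_probability (f theta x).

Definition one_hot (R : realType) (C : nat) (y : 'I_C) : 'rV[R]_C :=
  delta_mx 0 y.

Definition cross_entropy (R : realType) (C : nat) (q : 'rV[R]_C) (y : 'I_C) : R :=
  - (one_hot R y *m (map_mx (@ln R) q)^T) 0 0.

(* For a network_classifier and 1 <= p the supremum is a maximum: a continuous
   function is maximized over a nonempty compact ball. *)
Definition adversarial_loss (R : realType) (m d C : nat) (p : \bar R) (eps : R)
    (f : 'rV[R]_m -> 'rV[R]_d -> 'rV[R]_C)
    (x : 'rV[R]_d) (y : 'I_C) (theta : 'rV[R]_m) : R :=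
  sup [set cross_entropy (f theta x') y | x' in lp_ball p eps x].

(* Main.v *)
(* Danskin-type argument: let x' maximize the loss at theta over the compact
   ball around x.  Then t |-> L(f_t(x'), y) lies below J and touches it at
   theta, so their difference is minimal there and the two gradients agree.
   Hence the gradient of J at theta_i is within K eps of that of the clean loss,
   and two triangle inequalities conclude. *)
Require Import Defs.
From HB Require Import structures.
From mathcomp Require Import all_boot all_order all_algebra.
From mathcomp Require Import all_classical all_reals all_analysis.
From mathcomp Require Import ring.

Set Implicit Arguments.
Unset Strict Implicit.
Unset Printing Implicit Defensive.

Import Order.TTheory GRing.Theory Num.Theory.
Import numFieldNormedType.Exports.
Local Open Scope classical_set_scope.
Local Open Scope ring_scope.

(** * The Euclidean norm: Cauchy-Schwarz and the triangle inequality *)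

Lemma l2_norm_ge0 (R : realType) (n : nat) (v : 'rV[R]_n) : 0 <= l2_norm v.
Proof. exact: sqrtr_ge0. Qed.

Lemma l2_normN (R : realType) (n : nat) (v : 'rV[R]_n) :
  l2_norm (- v) = l2_norm v.
Proof.
by rewrite /l2_norm; congr Num.sqrt; apply: eq_bigr => i _; rewrite mxE sqrrN.
Qed.

Lemma sqr_l2_norm (R : realType) (n : nat) (v : 'rV[R]_n) :
  l2_norm v ^+ 2 = \sum_(i < n) v 0 i ^+ 2.
Proof. by rewrite sqr_sqrtr// sumr_ge0// => i _; exact: sqr_ge0. Qed.

(** With [a], [b] the norms of [u], [v] and [s] their inner product, the sum of the squares of
    [b * u_i - a * v_i] expands to [2ab(ab - s)]. Dividing by [ab] requires nonzero norms, hence the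
    two degenerate cases. *)
Lemma l2_norm_cauchy_schwarz (R : realType) (n : nat) (u v : 'rV[R]_n) :
  \sum_(i < n) u 0 i * v 0 i <= l2_norm u * l2_norm v.
Proof.
set a := l2_norm u; set b := l2_norm v.
have a0 : 0 <= a by exact: l2_norm_ge0.
have b0 : 0 <= b by exact: l2_norm_ge0.
have coord0 (w : 'rV[R]_n) : l2_norm w = 0 -> forall i, w 0 i = 0.
  move=> w0 i; have := sqr_l2_norm w; rewrite w0 expr0n/= => /esym/eqP.
  rewrite psumr_eq0; last by move=> j _; exact: sqr_ge0.
  by move=> /allP/(_ i (mem_index_enum i)); rewrite /= sqrf_eq0 => /eqP.
have [/coord0 ui0|an0] := eqVneq a 0.
  by rewrite big1 ?mulr_ge0// => i _; rewrite ui0 mul0r.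
have [/coord0 vi0|bn0] := eqVneq b 0.
  by rewrite big1 ?mulr_ge0// => i _; rewrite vi0 mulr0.
have ab0 : 0 < a * b by rewrite mulr_gt0// lt_def ?an0 ?bn0.
have : 0 <= \sum_(i < n) (b * u 0 i - a * v 0 i) ^+ 2.
  by apply: sumr_ge0 => i _; exact: sqr_ge0.
have -> : \sum_(i < n) (b * u 0 i - a * v 0 i) ^+ 2 =
    b ^+ 2 * \sum_(i < n) u 0 i ^+ 2 + a ^+ 2 * \sum_(i < n) v 0 i ^+ 2
    - (a * b) * (\sum_(i < n) u 0 i * v 0 i) *+ 2.
  rewrite -mulrnAr -sumrMnl !mulr_sumr -sumrN -!big_split/=.
  by apply: eq_bigr => i _; ring.
rewrite -!sqr_l2_norm -/a -/b; set s := \sum_(i < n) _ => h.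
rewrite -subr_ge0 -(pmulr_rge0 _ ab0).
have -> : a * b * (a * b - s) =
  (b ^+ 2 * a ^+ 2 + a ^+ 2 * b ^+ 2 - (a * b) * s *+ 2) / 2 by field.
by rewrite divr_ge0.
Qed.

Lemma l2_norm_triangle (R : realType) (n : nat) (u v : 'rV[R]_n) :
  l2_norm (u + v) <= l2_norm u + l2_norm v.
Proof.
rewrite -(ler_pXn2r (n := 2))// ?nnegrE ?addr_ge0 ?l2_norm_ge0//.
rewrite sqrrD !sqr_l2_norm.
have -> : \sum_(i < n) (u + v) 0 i ^+ 2 = \sum_(i < n) u 0 i ^+ 2
    + (\sum_(i < n) u 0 i * v 0 i) *+ 2 + \sum_(i < n) v 0 i ^+ 2.
  rewrite -sumrMnl -!big_split/=.
  by apply: eq_bigr => i _; rewrite mxE sqrrD.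
by rewrite lerD2r lerD2l lerMn2r l2_norm_cauchy_schwarz.
Qed.

(** * The l_p norm and compactness of its balls *)

Lemma powR_norm_continuous (R : realType) (r : R) :
  0 < r -> continuous (fun u : R => `|u| `^ r).
Proof.
move=> r0 u; have [->|u0] := eqVneq u 0.
  apply/cvgrPdist_lt => e e0; near=> t.
  rewrite normr0 powR0 ?gt_eqF// sub0r normrN ger0_norm ?powR_ge0//.
  (* At 0 the radius e^(1/r) works, since the power is increasing on the nonnegative reals. *)
  have -> : e = (e `^ r^-1) `^ r.
    by rewrite -powRrM mulVf ?lt0r_neq0// powRr1// ltW.
  apply: gt0_ltr_powR; rewrite ?nnegrE ?powR_ge0//.
  near: t; exists (e `^ r^-1); first exact: powR_gt0.
  by move=> t /=; rewrite sub0r normrN.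
(* Away from 0, the power is differentiable at the positive number [|u|], hence continuous there. *)
apply: (@continuous_comp _ _ _ _ (fun z : R => z `^ r)).
  exact: norm_continuous.
apply: differentiable_continuous; apply/derivable1_diffP.
by apply: derivable_powR; rewrite in_itv/= andbT normr_gt0.
Unshelve. all: by end_near. Qed.

Lemma lp_norm_pinfty (R : realType) (n : nat) (v : 'rV[R]_n) :
  lp_norm +oo%E v = `|v|.
Proof.
rewrite /lp_norm [RHS]mx_normrE; apply/le_anti/andP; split.
  apply/bigmax_leP; split=> [|i _]; last exact: (le_bigmax _ _ (0, i)).
  by elim/big_ind: _ => // a b a0 b0; rewrite le_max a0.
apply/bigmax_leP; split=> [|[i j] _] /=.
  by elim/big_ind: _ => // a b a0 b0; rewrite le_max a0.
by rewrite ord1; exact: (le_bigmax _ (fun k => `|v 0 k|) j).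
Qed.

Lemma lp_norm_continuous (R : realType) (n : nat) (p : \bar R) :
  (1 <= p)%E -> continuous (@lp_norm R n p).
Proof.
case: p => [r| |]//.
- rewrite lee_fin => r1; have r0 : 0 < r by exact: lt_le_trans r1.
  (* The sum is nonnegative, so the outer power may be composed with an absolute value;
     [powR_norm_continuous] then covers the points where the sum vanishes. *)
  have -> : @lp_norm R n r%:E =
      (fun u : R => `|u| `^ r^-1) \o
      (fun v : 'rV[R]_n => \sum_(i < n) `|v 0 i| `^ r).
    apply/funext => v /=; rewrite ger0_norm//.
    by apply: sumr_ge0 => i _; exact: powR_ge0.
  move=> v; apply: continuous_comp; last first.
    by apply: powR_norm_continuous; rewrite invr_gt0.
  apply: continuous_big => [|i _ w]; first exact: add_continuous.
  apply: (@continuous_comp _ _ _ (fun w : 'rV[R]_n => w 0 i)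
    (fun u : R => `|u| `^ r)); first exact: coord_continuous.
  exact: powR_norm_continuous.
- move=> _; have -> : @lp_norm R n +oo%E = @Num.norm R 'rV[R]_n.
    by apply/funext => v; exact: lp_norm_pinfty.
  exact: norm_continuous.
Qed.

(** Here [|v|] is the sup norm; for finite [p], each entry contributes one term to the sum of
    powers. This gives boundedness of the l_p balls. *)
Lemma norm_le_lp_norm (R : realType) (n : nat) (p : \bar R) (v : 'rV[R]_n) :
  (1 <= p)%E -> `|v| <= lp_norm p v.
Proof.
case: p => [r| |]//; last by rewrite lp_norm_pinfty.
rewrite lee_fin => r1; have r0 : 0 < r by exact: lt_le_trans r1.
rewrite [leLHS]mx_normrE; apply/bigmax_leP; split=> [|[i j] _] /=.
  exact: powR_ge0.
rewrite ord1 -[leLHS]powRr1// -(mulfV (lt0r_neq0 r0)) powRrM.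
apply: ge0_ler_powR; rewrite ?invr_ge0 ?(ltW r0) ?nnegrE ?powR_ge0//.
  by apply: sumr_ge0 => k _; exact: powR_ge0.
by rewrite (bigD1 j)//= lerDl sumr_ge0// => k _; exact: powR_ge0.
Qed.

(** Multiples of a basis vector give points at a prescribed distance from [x], whatever [p] is; they
    later show that the ball is nonempty and that [K] is nonnegative. *)
Lemma lp_norm_delta (R : realType) (n : nat) (p : \bar R) (a : R) (i : 'I_n) :
  (1 <= p)%E -> lp_norm p (a *: delta_mx 0 i) = `|a|.
Proof.
case: p => [r| |]//.
  rewrite lee_fin => r1; have r0 : 0 < r by exact: lt_le_trans r1.
  rewrite /lp_norm (bigD1 i)//= big1 ?addr0.
    by rewrite !mxE !eqxx mulr1 -powRrM mulfV ?lt0r_neq0// powRr1.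
  by move=> j /negPf ji; rewrite !mxE ji andbF mulr0 normr0 powR0// lt0r_neq0.
move=> _; rewrite lp_norm_pinfty normrZ.
suff -> : `|delta_mx 0 i : 'rV[R]_n| = 1 by rewrite mulr1.
rewrite [LHS]mx_normrE; apply/le_anti/andP; split.
  apply/bigmax_leP; split=> [|[k j] _] /=; first exact: ler01.
  by rewrite mxE; case: (_ && _); rewrite ?normr1 ?normr0.
by apply: le_trans (le_bigmax _ _ (0, i)); rewrite /= mxE !eqxx normr1.
Qed.

(** Heine-Borel: the sup norm is at most [eps + |x|] on the ball, which is closed as the preimage of
    a half-line under a continuous map. *)
Lemma lp_ball_compact (R : realType) (d : nat) (p : \bar R) (eps : R)
    (x : 'rV[R]_d) : (1 <= p)%E -> compact (lp_ball p eps x).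
Proof.
move=> p1; apply: bounded_closed_compact.
  exists (eps + `|x|); split; first exact: num_real.
  move=> M /ltW hM v /= vx; apply: le_trans hM.
  rewrite -[v](subrK x); apply: le_trans (ler_normD _ _) _.
  by rewrite lerD2r; apply: le_trans vx; exact: norm_le_lp_norm.
rewrite (_ : lp_ball p eps x =
    (fun v : 'rV[R]_d => lp_norm p (v - x)) @^-1` [set r : R | r <= eps]) //.
apply: preimage_closed; last exact: closed_le.
move=> v _; apply: (@continuous_comp _ _ _ (fun v : 'rV[R]_d => v - x)).
  by exact: cvgB cvg_id (cvg_cst _).
exact: lp_norm_continuous.
Qed.

(** * Continuity of the cross-entropy in the input *)

Lemma cross_entropyE (R : realType) (C : nat) (q : 'rV[R]_C) (y : 'I_C) :
  cross_entropy q y = - ln (q 0 y).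
Proof.
rewrite /cross_entropy mxE (bigD1 y)//= big1 ?addr0.
  by rewrite !mxE !eqxx mul1r.
by move=> j /negPf jy; rewrite !mxE jy andbF mul0r.
Qed.

Lemma cross_entropy_continuous (R : realType) (m d C : nat)
    (f : 'rV[R]_m -> 'rV[R]_d -> 'rV[R]_C) (y : 'I_C) (theta : 'rV[R]_m) :
  network_classifier f -> continuous (fun x => cross_entropy (f theta x) y).
Proof.
move=> /(_ theta)[fc fpos] x.
have ln_c : {for x, continuous (@ln R \o (fun z => f theta z 0 y))}.
  apply: continuous_comp; last by apply: continuous_ln; exact: (fpos x).1.
  apply: (@continuous_comp _ _ _ (f theta) (fun q : 'rV[R]_C => q 0 y)).
    exact: fc.
  exact: coord_continuous.
rewrite (_ : (fun _ => _) = fun z => - (@ln R \o (fun z => f theta z 0 y)) z).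
  exact: cvgN ln_c.
by apply/funext => z; rewrite cross_entropyE.
Qed.

(** * First-order conditions at a global minimum *)

Lemma derive_ge0_at_min (R : realType) (V : normedModType R) (g : V -> R)
    (a v : V) :
  derivable g a v -> (forall t, g a <= g t) -> 0 <= 'D_v g a.
Proof.
move=> dg gmin; rewrite ['D_v g a]cvg_at_rightE//.
apply: limr_ge.
  (* The two-sided difference quotient converges, hence so does its restriction to positive steps,
     where it is nonnegative. *)
  rewrite -(cvg_at_rightE (fun h : R => h^-1 *: ((g \o shift a) _ - g a)))//.
  apply: cvg_trans dg; apply: cvg_app.
  move=> A [e egt0 Ae]; exists e => // x xe xgt0.
  by apply: Ae => //; exact/lt0r_neq0.
near=> h; apply: mulr_ge0.
  by rewrite invr_ge0; apply: ltW; near: h; exists 1 => /=.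
by rewrite subr_ge0; exact: gmin.
Unshelve. all: by end_near. Qed.

Lemma derive_eq0_at_min (R : realType) (V : normedModType R) (g : V -> R)
    (a v : V) :
  differentiable g a -> (forall t, g a <= g t) -> 'D_v g a = 0.
Proof.
move=> dg gmin; apply/le_anti/andP; split; last first.
  by apply: derive_ge0_at_min => //; exact: diff_derivable.
(* The differential is linear in the direction, so the one-sided bound along [- v] gives the
   opposite inequality. *)
rewrite -oppr_ge0 deriveE// -linearN -deriveE//.
by apply: derive_ge0_at_min => //; exact: diff_derivable.
Qed.

(** [F - G] is nonnegative and vanishes at [a], so its directional derivatives there are zero. *)
Lemma gradient_eq_touching (R : realType) (m : nat) (F G : 'rV[R]_m -> R)
    (a : 'rV[R]_m) :
  differentiable F a -> differentiable G a ->
  (forall t, G t <= F t) -> G a = F a -> gradient F a = gradient G a.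
Proof.
move=> dF dG GF GFa; apply/rowP => i; rewrite !mxE.
apply/eqP; rewrite -subr_eq0 -deriveB; try exact: diff_derivable.
apply/eqP; apply: derive_eq0_at_min; first exact: differentiableB.
by move=> t; rewrite !fctE GFa subrr subr_ge0.
Qed.

(** * The adversarial loss as an attained maximum, and its gradient *)

Section adversarial_loss_theory.
Context {R : realType} {m d C : nat} (p : \bar R) (eps : R).
Variables (f : 'rV[R]_m -> 'rV[R]_d -> 'rV[R]_C) (y : 'I_C).
Hypotheses (p_ge1 : (1 <= p)%E) (f_network : network_classifier f).

(** A real [sup] dominates a set only if that set is bounded above; the extreme value theorem on the
    compact ball supplies the bound. *)
Lemma cross_entropy_le_adversarial_loss (x x' : 'rV[R]_d) (theta : 'rV[R]_m) :
  lp_ball p eps x x' ->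
  cross_entropy (f theta x') y <= adversarial_loss p eps f x y theta.
Proof.
move=> xx'; apply: ub_le_sup; last by exists x'.
have [|||x0 _ x0max] := @compact_EVT_max _ _
  (fun z => cross_entropy (f theta z) y) (lp_ball p eps x).
- by exists x'.
- exact: lp_ball_compact.
- by apply: continuous_subspaceT; exact: cross_entropy_continuous.
exists (cross_entropy (f theta x0) y) => _ [z xz <-].
by apply: x0max; rewrite inE.
Qed.

Lemma adversarial_loss_attained (x : 'rV[R]_d) (theta : 'rV[R]_m) :
  lp_ball p eps x !=set0 ->
  exists2 x', lp_ball p eps x x' &
    cross_entropy (f theta x') y = adversarial_loss p eps f x y theta.
Proof.
move=> ball0; have [||x0 x0ball x0max] := @compact_EVT_max _ _
  (fun z => cross_entropy (f theta z) y) (lp_ball p eps x) ball0.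
- exact: lp_ball_compact.
- by apply: continuous_subspaceT; exact: cross_entropy_continuous.
rewrite inE in x0ball; exists x0 => //.
apply/le_anti/andP; split; first exact: cross_entropy_le_adversarial_loss.
apply: sup_le_ub; first by exists (cross_entropy (f theta x0) y), x0.
by move=> _ [z xz <-]; apply: x0max; rewrite inE.
Qed.

(** The maximizer [x'] is chosen at [theta] and then frozen while the parameter [t] varies, which
    makes the clean loss at [x'] touch the adversarial loss from below. *)
Lemma gradient_adversarial_loss (x : 'rV[R]_d) (theta : 'rV[R]_m) :
  lp_ball p eps x !=set0 ->
  (forall x', differentiable (fun t => cross_entropy (f t x') y) theta) ->
  differentiable (adversarial_loss p eps f x y) theta ->
  exists2 x', lp_ball p eps x x' &
    gradient (adversarial_loss p eps f x y) theta =
    gradient (fun t => cross_entropy (f t x') y) theta.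
Proof.
move=> ball0 dL dJ; have [x' xx' Lx'] := adversarial_loss_attained theta ball0.
exists x' => //; apply: gradient_eq_touching => // t.
exact: cross_entropy_le_adversarial_loss.
Qed.

End adversarial_loss_theory.

Theorem theorem1 (R : realType) (m d C : nat) (p : \bar R) (eps K : R)
    (f : 'rV[R]_m -> 'rV[R]_d -> 'rV[R]_C) (y : 'I_C)
    (d_gt0 : (0 < d)%N) (p_ge1 : (1 <= p)%E) (eps_gt0 : 0 < eps)
    (f_network : network_classifier f)
    (L_diff : forall (x : 'rV[R]_d) (theta : 'rV[R]_m),
      differentiable (fun t => cross_entropy (f t x) y) theta)
    (L_lipschitz : forall (x x' : 'rV[R]_d) (theta : 'rV[R]_m),
      lp_ball p eps x x' ->
      l2_norm (gradient (fun t => cross_entropy (f t x') y) theta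
             - gradient (fun t => cross_entropy (f t x) y) theta)
        <= K * lp_norm p (x' - x))
    (x : 'rV[R]_d) (theta1 theta2 : 'rV[R]_m)
    (J_diff1 : differentiable (adversarial_loss p eps f x y) theta1)
    (J_diff2 : differentiable (adversarial_loss p eps f x y) theta2) :
  l2_norm (gradient (adversarial_loss p eps f x y) theta1
         - gradient (adversarial_loss p eps f x y) theta2)
    <= l2_norm (gradient (fun t => cross_entropy (f t x) y) theta1
              - gradient (fun t => cross_entropy (f t x) y) theta2)
       + 2 * eps * K.
Proof.
have ball_delta (a : R) : `|a| <= eps ->
    lp_ball p eps x (x + a *: delta_mx 0 (Ordinal d_gt0)).
  by move=> a_eps; rewrite /lp_ball/= addrAC subrr add0r lp_norm_delta.
have ball0 : lp_ball p eps x !=set0.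
  exists (x + 0 *: delta_mx 0 (Ordinal d_gt0)).
  by apply: ball_delta; rewrite normr0 ltW.
(* If K < 0, the Lipschitz bound fails at a point at distance eps from x; such
   a point exists because d > 0. *)
have K_ge0 : 0 <= K.
  have eps_norm : `|eps| = eps by rewrite gtr0_norm.
  have := L_lipschitz _ _ theta1 (ball_delta eps _).
  rewrite eps_norm addrAC subrr add0r lp_norm_delta// eps_norm => /(_ (lexx _)).
  by move=> /(le_trans (l2_norm_ge0 _)); rewrite pmulr_lge0.
have gradJ theta : differentiable (adversarial_loss p eps f x y) theta ->
    l2_norm (gradient (adversarial_loss p eps f x y) theta
           - gradient (fun t => cross_entropy (f t x) y) theta) <= K * eps.
  move=> dJ; have [//|x' xx' ->] :=
    gradient_adversarial_loss p_ge1 f_network ball0 _ dJ.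
  (* The maximizer is within [eps] of [x], and [K_ge0] allows multiplying this bound by [K]. *)
  by apply: le_trans (L_lipschitz _ _ _ xx') _; rewrite ler_wpM2l.
have := gradJ _ J_diff1; have := gradJ _ J_diff2.
set J1 := gradient _ theta1; set J2 := gradient _ theta2.
set L1 := gradient _ theta1; set L2 := gradient _ theta2.
rewrite -l2_normN opprB => h2 h1.
(* Each adversarial gradient is paired with the clean one at the same parameter, so each of the last
   two brackets costs [K * eps]. *)
have -> : J1 - J2 = (L1 - L2) + ((J1 - L1) + (L2 - J2)).
  by apply/rowP => i; rewrite !mxE; ring.
apply: le_trans (l2_norm_triangle _ _) _; rewrite lerD2l.
apply: le_trans (l2_norm_triangle _ _) _.
have -> : 2 * eps * K = K * eps + K * eps by ring.
exact: lerD.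
Qed.
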